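(* There are absolute constants $0<a\le b$ such that for every fixed integer $k\ge 2$ and every sufficiently large $N$ (depending on $k$) there is an integer $c$ with $a\,\frac{\log N}{k}\le c\le b\,\frac{\log N}{k}$ (i.e. $c=\Theta(\log N/k)$) and an online $c$-coloring algorithm which colors any ordered set of $N$ points in the plane such that throughout the process all monochromatic wedges have size strictly less than $k$.
   Context: A wedge is a set $\{(x,y)\in\mathbb{R}^2 : x<x_0,\ y<y_0\}$ with fixed apex $(x_0,y_0)$, where $x_0=\infty$ and $y_0=\infty$ are also allowed. Given a finite set of colored points in the plane, the size of a wedge is the number of points of the set it contains, and a wedge is monochromatic if all the points of the set it contains have the same color. An online $c$-coloring algorithm is a (deterministic) rule that, when distinct points $p_1,p_2,\ldots$ of the plane arrive one at a time, assigns to $p_i$ on its arrival one of $c$ available colors, knowing only $p_1,\ldots,p_i$ and the colors of $p_1,\dots,p_{i-1}$; colors are never changed later and nothing is known about future points. The algorithm may depend on $N$ and $k$. ''Throughout the process'' means: for each $i$, with respect to the colored set $\{p_1,\dots,p_i\}$ right after $p_i$ has been colored. *)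

(* Defs.v *)
From HB Require Import structures.
From mathcomp Require Import all_boot all_order all_algebra.
From mathcomp Require Import all_classical all_reals all_analysis.

Set Implicit Arguments.
Unset Strict Implicit.
Unset Printing Implicit Defensive.

Import Order.TTheory GRing.Theory Num.Theory.

Local Open Scope classical_set_scope.
Local Open Scope ring_scope.

(* A coordinate of the apex may be +oo but not -oo. *)
Definition is_wedge (R : realType) (W : set (R * R)) : Prop :=
  exists x0 y0 : \bar R,
    [/\ x0 != -oo%E, y0 != -oo%E &
        W = [set p : R * R | (p.1%:E < x0)%E /\ (p.2%:E < y0)%E]].

(* Points paired with their colors, in order of arrival. *)
Definition colored_points (R : realType) (c : nat) := seq ((R * R) * 'I_c).

Definition wedge_size (R : realType) (c : nat) (W : set (R * R))
    (h : colored_points R c) : nat :=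
  count (fun q => q.1 \in W) h.

Definition monochromatic (R : realType) (c : nat) (W : set (R * R))
    (h : colored_points R c) : Prop :=
  forall q q', q \in h -> q' \in h -> q.1 \in W -> q'.1 \in W -> q.2 = q'.2.

(* The color of the arriving point is a function of the past points with their
   colors and of the point itself. *)
Definition online_algorithm (R : realType) (c : nat) :=
  colored_points R c -> R * R -> 'I_c.

Definition run (R : realType) (c : nat) (alg : online_algorithm R c)
    (s : seq (R * R)) : colored_points R c :=
  foldl (fun h p => rcons h (p, alg h p)) [::] s.

(* Main.v *)
Require Import Defs.
From HB Require Import structures.
From mathcomp Require Import all_boot all_order all_algebra.
From mathcomp Require Import all_classical all_reals all_analysis.
From mathcomp Require Import zify lra.

Set Implicit Arguments.
Unset Strict Implicit.
Unset Printing Implicit Defensive.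

Import Order.TTheory GRing.Theory Num.Theory.

Local Open Scope classical_set_scope.
Local Open Scope ring_scope.

(** Colors come from a hidden pair attached to each point on arrival: a level,
which is a natural number, and one of four tags.  The visible color is the pair
(level %/ (k - 1), tag), so a monochromatic wedge sees one tag and levels from
one block of k - 1 consecutive values.  Call a point minimal when no other
present point lies weakly below it in both coordinates.

Choice of the pair for a new point p.  If some present q is below p, then p
gets level 0 and a tag other than that of q: since every wedge through p
contains q, no wedge through p is ever monochromatic again.  If p is minimal,
its tag must avoid those of its two neighbours on the staircase of minimal
points; then every wedge containing p and a point not above p contains two
different tags.  Among the remaining tags (at least two) p takes the one
yielding the least level, where with tag t the level has to exceed the levels
of the formerly minimal points with tag t that lie above p.

Monochromatic wedges are small.  A monochromatic nonempty wedge W always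
contains a minimal point m such that the size of W is at most
level m %% (k - 1) + 1 ([monochromatic_wedge_bound]).  Indeed, when p joins such
a W, the tag rules force p to be minimal and below all points of W, so m has
the same tag and the same block as p but a smaller level: the remainder grows
at least by one together with the size.  Hence the size stays below k.

Levels are logarithmic.  If p gets level u + 1, then level u was refused to each
of the two or more available tags, so p lies below two distinct minimal points
of level at least u.  These stop being minimal when p arrives, so the sum of
2 ^ level over the minimal points increases by at most 1 at each arrival
([minimal_potential]).  Levels are thus at most log2 N, and
4 * (log2 N %/ (k - 1) + 1) colors suffice. *)

(** * Wedges as ideals of the product order *)

Definition below (R : realType) (q p : R * R) : bool :=
  (q.1 <= p.1) && (q.2 <= p.2).

Definition below_join (R : realType) (q p z : R * R) : bool :=
  (q.1 <= Num.max p.1 z.1) && (q.2 <= Num.max p.2 z.2).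

(** With z = p this is closure under going down; in general it says that a
point weakly below the join of two members is a member.  This is the only
property of wedges that the coloring relies on. *)
Definition ideal (R : realType) (W : set (R * R)) : Prop :=
  forall p z q, p \in W -> z \in W -> below_join q p z -> q \in W.

Lemma wedge_ideal (R : realType) (W : set (R * R)) : is_wedge W -> ideal W.
Proof.
move=> [x0 [y0 [_ _ ->]]] p z q; rewrite !inE /= => -[px py] [zx zy].
case/andP=> qx qy; split.
  by apply: (@le_lt_trans _ _ (Num.max p.1 z.1)%:E);
    rewrite ?lee_fin// EFin_max gt_max px zx.
by apply: (@le_lt_trans _ _ (Num.max p.2 z.2)%:E);
  rewrite ?lee_fin// EFin_max gt_max py zy.
Qed.

Lemma belowW (R : realType) (q p z : R * R) : below q p -> below_join q p z.
Proof. by case/andP=> h1 h2; rewrite /below_join !le_max h1 h2. Qed.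

Lemma ideal_below (R : realType) (W : set (R * R)) p q :
  ideal W -> p \in W -> below q p -> q \in W.
Proof. by move=> idW pW qp; apply: (idW p p) => //; apply: belowW. Qed.

(** * Choosing a level and a tag *)

Definition entry (R : realType) := ((R * R) * (nat * 'I_4))%type.

Definition level (R : realType) (e : entry R) : nat := e.2.1.
Definition entry_tag (R : realType) (e : entry R) : 'I_4 := e.2.2.

(** The comparison is between points, so that an entry is not its own
obstruction. *)
Definition is_minimal (R : realType) (h : seq (entry R)) (z : entry R) : bool :=
  all (fun z' => below z'.1 z.1 ==> (z'.1 == z.1)) h.

(** What a new point p needs.  For each past z, either every ideal through p and
z contains a past point with a tag other than that of p, or else p becomes a new
minimal point below z, and its level is above that of z when z is minimal with
the same tag.  The last clause pays for the new weight 2 ^ level of p by the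
weights of the minimal points above p, which disappear, plus 1 for p itself. *)
Definition good_choice (R : realType) (h : seq (entry R)) (p : R * R)
    (vt : nat * 'I_4) : Prop :=
  (forall z, z \in h ->
    (exists z', [/\ z' \in h, below_join z'.1 p z.1 & entry_tag z' != vt.2]) \/
    [/\ below p z.1, forall q, q \in h -> ~~ below q.1 p
      & is_minimal h z -> entry_tag z = vt.2 -> (level z < vt.1)%N]) /\
  (2 ^ vt.1 <= 1 + \sum_(z <- h | is_minimal h z && below p z.1) 2 ^ level z)%N.

Lemma exists_argmin (R : realType) (T : eqType) (f : T -> R) (s : seq T) :
  s != [::] -> exists2 m, m \in s & forall z, z \in s -> f m <= f z.
Proof.
elim: s => // x [|y s] IH _.
  by exists x; rewrite ?mem_head// => z; rewrite inE => /eqP ->.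
have [//|m ms mmin] := IH; have [le|/ltW le] := lerP (f x) (f m).
  exists x; rewrite ?mem_head// => z; rewrite inE => /orP[/eqP->//|/mmin].
  exact: le_trans.
exists m; first by rewrite inE ms orbT.
by move=> z; rewrite inE => /orP[/eqP->//|/mmin].
Qed.

(** Applied to the points strictly to the left of p with f the height, this
gives the tag of the left neighbour of p on the staircase; exchanging the
coordinates gives the right one.  If there is no such point, any tag will do. *)
Lemma exists_neighbour_tag (R : realType) (h : seq (entry R))
    (P : pred (entry R)) (f : entry R -> R) :
  exists t : 'I_4, forall z, z \in h -> P z ->
    exists z', [/\ z' \in h, P z', f z' <= f z & entry_tag z' = t].
Proof.
have [E|/exists_argmin -/(_ _ f)[m]] := eqVneq [seq z <- h | P z] [::].
  exists ord0 => z zh Pz; have: z \in [seq z <- h | P z] by rewrite mem_filter Pz.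
  by rewrite E.
rewrite mem_filter => /andP[Pm mh] mmin; exists (entry_tag m) => z zh Pz.
by exists m; split=> //; apply: mmin; rewrite mem_filter Pz.
Qed.

(** Four tags are needed here: the two neighbours forbid up to two of them, and
doubling the weight from one level to the next takes two more. *)
Lemma two_other_tags (a b : 'I_4) :
  exists t1 t2 : 'I_4, [/\ t1 != t2, t1 \notin [set a; b]%SET & t2 \notin [set a; b]%SET].
Proof.
have : (1 < #|(~: [set a; b])%SET|)%N.
  by have := cardsC [set a; b]%SET; rewrite cards2 card_ord; case: (a != b) => /=; lia.
by case/card_gt1P=> t1 [t2 []]; rewrite !finset.in_setC => ? ? ?; exists t1, t2.
Qed.

Lemma leq_sum_two (T : eqType) (s : seq T) (P : pred T) (F : T -> nat) (x y : T) :
  x != y -> x \in s -> y \in s -> P x -> P y ->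
  (F x + F y <= \sum_(z <- s | P z) F z)%N.
Proof.
move=> xy xs ys Px Py; rewrite (big_rem x)//= Px leq_add2l.
rewrite (big_rem y)/= ?Py ?leq_addr//.
by have := perm_mem (perm_to_rem xs) y; rewrite ys inE eq_sym (negbTE xy).
Qed.

(** Avoiding the tags of both neighbours settles all z not above p: such a z is
strictly to the left of p or strictly lower than p, and the neighbour on that
side is at most as high, respectively at most as far right, as z, hence lies
below the join of p and z.  Taking the least feasible level over all allowed
tags gives the weight clause: failure of the previous level at two tags exhibits
two distinct minimal points above p of at least that level. *)
Lemma exists_good_choice (R : realType) (h : seq (entry R)) (p : R * R) :
  exists vt, good_choice h p vt.
Proof.
have [/hasP[q qh qp]|/hasPn pmin] := boolP (has (fun q => below q.1 p) h).
  have [t [_ [_ tq _]]] := two_other_tags (entry_tag q) (entry_tag q).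
  exists (0%N, t); split=> [z zh|]; last exact: leq_addr.
  left; exists q; split=> //; first exact: belowW.
  by apply: contraNneq tq => /= <-; rewrite !inE eqxx.
(* From here on p is minimal; a and b are the tags of its neighbours. *)
have [a aP] := exists_neighbour_tag h (fun z => z.1.1 < p.1) (fun z => z.1.2).
have [b bP] := exists_neighbour_tag h (fun z => z.1.2 < p.2) (fun z => z.1.1).
pose K z := is_minimal h z && below p z.1.
pose free v t := (t \notin [set a; b]%SET) &&
  all (fun z => (K z && (entry_tag z == t)) ==> (level z < v)%N) h.
pose Q v := [exists t, free v t].
have exQ : exists v, Q v.
  have [t [_ [_ tab _]]] := two_other_tags a b.
  exists (\max_(z <- h) level z).+1; apply/existsP; exists t; apply/andP; split=> //.
  apply/allP => z zh; apply/implyP => _; rewrite ltnS.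
  exact: (leq_bigmax_seq (F := fun z => level z)).
case: (ex_minnP exQ) => v /existsP[t /andP[tab /allP tfree]] vmin.
exists (v, t); split=> /= [z zh|].
- move: tab; rewrite !inE negb_or => /andP[ta tb].
  have [zx|xz] := ltP z.1.1 p.1.
    have [z' [z'h z'x z'y z't]] := aP z zh zx.
    left; exists z'; split=> //; last by rewrite z't eq_sym.
    by rewrite /below_join !le_max (ltW z'x) z'y orbT.
  have [zy|yz] := ltP z.1.2 p.2.
    have [z' [z'h z'y z'x z't]] := bP z zh zy.
    left; exists z'; split=> //; last by rewrite z't eq_sym.
    by rewrite /below_join !le_max (ltW z'y) z'x orbT.
  have pz : below p z.1 by rewrite /below xz yz.
  right; split=> // az zt.
  by move: (tfree z zh); rewrite /K az pz zt eqxx.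
- case: v vmin {tfree} => [|u] vmin; first exact: leq_addr.
  have block t' : t' \notin [set a; b]%SET ->
      exists z, [/\ z \in h, K z, entry_tag z = t' & (u <= level z)%N].
    move=> t'ab; have : ~~ free u t'.
      apply/negP => fr; have : Q u by apply/existsP; exists t'.
      by move/vmin; rewrite ltnn.
    rewrite /free t'ab /= => /allPn[z zh]; rewrite negb_imply -leqNgt.
    by case/andP=> /andP[Kz /eqP zt] uz; exists z.
  have [t1 [t2 [t12 t1ab t2ab]]] := two_other_tags a b.
  have [z1 [z1h K1 z1t l1]] := block _ t1ab.
  have [z2 [z2h K2 z2t l2]] := block _ t2ab.
  have z12 : z1 != z2 by apply: contraNneq t12 => E; rewrite -z1t -z2t E.
  have := leq_sum_two (fun z => 2 ^ level z)%N z12 z1h z2h K1 K2.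
  rewrite expnS mul2n -addnn => le; apply: leq_trans (leq_addl 1%N _).
  by apply: leq_trans le; rewrite leq_add// leq_exp2l.
Qed.

(** * Invariants of the process *)

Definition hidden_run (R : realType)
    (ch : seq (entry R) -> R * R -> nat * 'I_4) (s : seq (R * R)) : seq (entry R) :=
  foldl (fun h p => rcons h (p, ch h p)) [::] s.

Lemma hidden_run_rcons (R : realType) ch (s : seq (R * R)) p :
  hidden_run ch (rcons s p) = rcons (hidden_run ch s) (p, ch (hidden_run ch s) p).
Proof. by rewrite /hidden_run -cats1 foldl_cat. Qed.

Lemma points_hidden_run (R : realType) ch (s : seq (R * R)) :
  [seq e.1 | e <- hidden_run ch s] = s.
Proof. by elim/last_ind: s => // s p IH; rewrite hidden_run_rcons map_rcons IH. Qed.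

Lemma mem_hidden_run (R : realType) ch (s : seq (R * R)) e :
  e \in hidden_run ch s -> e.1 \in s.
Proof. by move=> /(map_f fst); rewrite points_hidden_run. Qed.

Lemma is_minimal_rcons (R : realType) (h : seq (entry R)) e z :
  is_minimal (rcons h e) z = (below e.1 z.1 ==> (e.1 == z.1)) && is_minimal h z.
Proof. by rewrite /is_minimal all_rcons. Qed.

(** A new entry of level v adds 2 ^ v, but the minimal points above it cease to
be minimal, and by the choice of v they carried weight at least 2 ^ v - 1. *)
Lemma minimal_potential (R : realType) (ch : seq (entry R) -> R * R -> nat * 'I_4) s :
  (forall h p, good_choice h p (ch h p)) -> uniq s ->
  (\sum_(z <- hidden_run ch s | is_minimal (hidden_run ch s) z) 2 ^ level z <= size s)%N.
Proof.
move=> chP; elim/last_ind: s => [|s p IH]; first by rewrite big_nil.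
rewrite rcons_uniq => /andP[ps us]; rewrite hidden_run_rcons size_rcons.
set h := hidden_run ch s; set e := (p, ch h p).
rewrite big_rcons/=; have [_] := chP h p; rewrite -/(level e).
have := IH us; rewrite -/h (bigID (fun z => below p z.1))/=.
set A := (X in (X + _ <= _)%N); set B := (X in (_ + X <= _)%N) => leh lee.
have leB : (\sum_(z <- h | is_minimal (rcons h e) z) 2 ^ level z <= B)%N.
  rewrite /B big_seq_cond [leqRHS]big_seq_cond.
  apply: sub_le_big => //= [x y|z]; first exact: leq_addr.
  case/andP=> zh; rewrite zh is_minimal_rcons /= => /andP[pz ->] /=.
  apply/negP => bp; move: pz; rewrite bp /= => /eqP E.
  by move: ps; rewrite E (mem_hidden_run zh).
have {}lee : (2 ^ level e <= 1 + A)%N := lee.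
apply: (@leq_trans (B + 2 ^ level e)); first by rewrite leq_add//; case: ifP.
by move: (2 ^ level e)%N A B lee leh {leB} => x A B; lia.
Qed.

(** This includes points that were not minimal on arrival and points that have
ceased to be minimal, because the weight clause is applied at the time when e
arrives. *)
Lemma level_bound (R : realType) (ch : seq (entry R) -> R * R -> nat * 'I_4) s e :
  (forall h p, good_choice h p (ch h p)) -> uniq s -> e \in hidden_run ch s ->
  (2 ^ level e <= size s)%N.
Proof.
move=> chP; elim/last_ind: s => // s p IH; rewrite rcons_uniq => /andP[_ us].
rewrite hidden_run_rcons mem_rcons inE size_rcons.
case/orP=> [/eqP -> |/(IH us)/leqW//].
have [_ le] := chP (hidden_run ch s) p; apply: (leq_trans le).
rewrite add1n ltnS; apply: leq_trans (minimal_potential chP us).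
by rewrite [leqRHS](bigID (fun z => below p z.1))/= leq_addr.
Qed.

(** The size is measured against the level of one minimal point of the wedge.
It has to be minimal because only the levels of minimal points constrain a
newcomer; when a newcomer joins the wedge, it takes over this role. *)
Lemma monochromatic_wedge_bound (R : realType) (ch : seq (entry R) -> R * R -> nat * 'I_4)
    (d : nat) s (W : set (R * R)) :
  (forall h p, good_choice h p (ch h p)) -> ideal W -> uniq s ->
  let h := hidden_run ch s in
  (forall e e', e \in h -> e' \in h -> e.1 \in W -> e'.1 \in W ->
     entry_tag e = entry_tag e' /\ (level e %/ d = level e' %/ d)%N) ->
  (0 < count (fun e => e.1 \in W) h)%N ->
  exists m, [/\ m \in h, m.1 \in W, is_minimal h m
    & (count (fun e => e.1 \in W) h <= (level m %% d).+1)%N].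
Proof.
move=> chP idW; elim/last_ind: s => // s p IH.
rewrite rcons_uniq => /andP[ps us] /=; rewrite hidden_run_rcons.
set h := hidden_run ch s; set e := (p, ch h p) => mono.
have eh' : e \in rcons h e by rewrite mem_rcons mem_head.
have sub z : z \in h -> z \in rcons h e by rewrite mem_rcons inE orbC => ->.
have {IH} IH : (0 < count (fun e => e.1 \in W) h)%N -> _ :=
  IH us (fun x y xh yh => mono x y (sub x xh) (sub y yh)).
rewrite -cats1 count_cat /= addn0 cats1.
have [pW|pW] := boolP (p \in W); last first.
  rewrite addn0 => /IH[m [mh mW ma mc]]; exists m; split=> //; first exact: sub.
  rewrite is_minimal_rcons ma andbT; apply/implyP => bp.
  by case/negP: pW; apply: ideal_below mW bp.
move=> _; have [c0|/IH[m [mh mW ma mc]]] := posnP (count (fun e => e.1 \in W) h).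
  exists e; split; rewrite ?c0 //; rewrite is_minimal_rcons eqxx implybT /=.
  apply/allP => z zh; apply/implyP => zp; move/eqP: c0; rewrite -leqn0 leqNgt -has_count.
  by case/hasP; exists z => //; apply: ideal_below pW zp.
have [spec _] := chP h p.
(* The first alternative produces a second tag inside W. *)
have [[z' [z'h z'j]]|[pm pmin lm]] := spec m mh.
  have [] := mono e z' eh' (sub _ z'h) pW (idW _ _ _ pW mW z'j).
  by rewrite /e /entry_tag /= => ->; rewrite eqxx.
have [tm dm] := mono m e (sub _ mh) eh' mW pW.
exists e; split=> //.
  rewrite is_minimal_rcons eqxx implybT /=; apply/allP => z zh.
  by rewrite (negbTE (pmin z zh)).
rewrite addn1 ltnS; apply: (leq_trans mc).
have {}lm : (level m < level e)%N := lm ma tm.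
move: lm; rewrite {1}(divn_eq (level m) d) {1}(divn_eq (level e) d) dm.
by rewrite ltn_add2l.
Qed.

(** * From hidden pairs to online colors *)

(** Mixed radix: blocks are the high digit and tags the low one.  The number of
colors, 4 * (L %/ d + 1), is written as a successor for the sake of [inord]. *)
Definition encode (L d : nat) (vt : nat * 'I_4) : 'I_(L %/ d * 4 + 3).+1 :=
  inord (vt.1 %/ d * 4 + vt.2).

Lemma encode_inj L d vt vt' : (vt.1 <= L)%N -> (vt'.1 <= L)%N ->
  encode L d vt = encode L d vt' -> vt.2 = vt'.2 /\ (vt.1 %/ d = vt'.1 %/ d)%N.
Proof.
move=> l l' /(congr1 val); rewrite /= !inordK; last first.
- by have := leq_div2r d l; have := ltn_ord vt.2; lia.
- by have := leq_div2r d l'; have := ltn_ord vt'.2; lia.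
have := ltn_ord vt.2; have := ltn_ord vt'.2 => t' t E.
by split; [apply: val_inj|] => /=; lia.
Qed.

Lemma run_rcons (R : realType) (c : nat) (alg : online_algorithm R c) s p :
  run alg (rcons s p) = rcons (run alg s) (p, alg (run alg s) p).
Proof. by rewrite /run -cats1 foldl_cat. Qed.

(** Colors do not reveal levels, but the algorithm is deterministic: it replays
the hidden process on the past points to recover them. *)
Lemma run_hidden (R : realType) (L d : nat) ch (s : seq (R * R)) :
  run (fun h p => encode L d (ch (hidden_run ch [seq q.1 | q <- h]) p)) s =
  [seq (e.1, encode L d e.2) | e <- hidden_run ch s].
Proof.
elim/last_ind: s => // s p IH; rewrite run_rcons IH hidden_run_rcons map_rcons.
by rewrite -map_comp (eq_map (g := fst))// points_hidden_run.
Qed.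

Lemma online_coloring (R : realType) (d N : nat) : (0 < d)%N ->
  exists alg : online_algorithm R (trunc_log 2 N %/ d * 4 + 3).+1,
  forall s : seq (R * R), uniq s -> (size s <= N)%N ->
  forall W : set (R * R), is_wedge W ->
    monochromatic W (run alg s) -> (wedge_size W (run alg s) <= d)%N.
Proof.
move=> d0; set L := trunc_log 2 N.
have [ch chP] := boolp.choice (fun hp : seq (entry R) * (R * R) =>
  exists_good_choice hp.1 hp.2).
pose ch' h p := ch (h, p).
have ch'P h p : good_choice h p (ch' h p) := chP (h, p).
exists (fun h p => encode L d (ch' (hidden_run ch' [seq q.1 | q <- h]) p)).
move=> s us sN W /wedge_ideal idW; rewrite run_hidden => mono.
rewrite /wedge_size count_map; set h := hidden_run ch' s in mono *.
have lev e : e \in h -> (level e <= L)%N.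
  by move=> /(level_bound ch'P us) le; apply: trunc_log_max => //; apply: leq_trans sN.
rewrite (eq_count (a2 := fun e => e.1 \in W))//.
have [->//|cpos] := posnP (count (fun e : entry R => e.1 \in W) h).
have [|m [_ _ _ le]] := monochromatic_wedge_bound ch'P (d := d) idW us _ cpos.
  move=> e e' eh e'h eW e'W; apply: (@encode_inj L) (lev _ eh) (lev _ e'h) _.
  exact: (mono (e.1, _) (e'.1, _) (map_f _ eh) (map_f _ e'h) eW e'W).
by apply: leq_trans le _; rewrite ltn_mod.
Qed.

(** * Counting colors *)

Lemma trunc_log_ln (R : realType) (N : nat) : (0 < N)%N ->
  (trunc_log 2 N)%:R <= 2 * ln N%:R :> R /\ ln N%:R <= (trunc_log 2 N).+1%:R :> R.
Proof.
move=> N0; have N0' : 0 < N%:R :> R by rewrite ltr0n.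
have ln2_le1 : ln 2%:R <= 1 :> R.
  by have := @le_ln1Dx R 1; rewrite (_ : 1 + 1 = 2%:R)//; apply; lra.
(* ln 2 = - ln (1 - 1/2) >= 1/2. *)
have ln2_ge : 2^-1 <= ln 2%:R :> R.
  have : ln (1 + - 2^-1) <= - 2^-1 :> R by apply: le_ln1Dx; lra.
  have -> : 1 + - 2^-1 = 2%:R^-1 :> R by lra.
  by rewrite lnV ?posrE//; lra.
have /andP[lo hi] := trunc_log_bounds (isT : (1 < 2)%N) N0.
have loR : ln (2%:R ^+ trunc_log 2 N) <= ln N%:R :> R.
  by rewrite ler_ln ?posrE ?exprn_gt0// -natrX ler_nat.
have hiR : ln N%:R <= ln (2%:R ^+ (trunc_log 2 N).+1) :> R.
  by rewrite ler_ln ?posrE ?exprn_gt0// -natrX ler_nat ltnW.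
rewrite lnXn// -[_ *+ trunc_log 2 N]mulr_natl in loR.
rewrite lnXn// -[_ *+ (trunc_log 2 N).+1]mulr_natl in hiR.
have L0 : 0 <= (trunc_log 2 N)%:R :> R by [].
have le2 := ler_wpM2l L0 ln2_ge.
split; first by have := le_trans le2 loR; lra.
by apply: le_trans hiR _; rewrite ler_piMr.
Qed.

Theorem corollary6 (R : realType) :
  exists a b : R, 0 < a /\ a <= b /\
    forall k : nat, (2 <= k)%N ->
    exists N0 : nat, forall N : nat, (N0 <= N)%N ->
    exists c : nat,
      a * (ln N%:R / k%:R) <= c%:R /\ c%:R <= b * (ln N%:R / k%:R) /\
      exists alg : online_algorithm R c,
        forall s : seq (R * R), uniq s -> size s = N ->
        forall i : nat, (1 <= i <= N)%N ->
        forall W : set (R * R), is_wedge W ->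
          monochromatic W (run alg (take i s)) ->
          (wedge_size W (run alg (take i s)) < k)%N.
Proof.
(* With L = trunc_log 2 N and c = 4 * (L %/ (k - 1) + 1), the product c * k is
   at least 4 * (L + 1) >= ln N.  Conversely k <= 2 * (k - 1) and k <= L give
   c * k <= 8 * L + 4 * L = 12 * L <= 24 * ln N. *)
exists 1, 24%:R; split; first lra; split; first lra.
(* N >= 2 ^ k ensures k <= L, which absorbs the rounding in c. *)
move=> k k2; exists (2 ^ k)%N => N kN.
have N0 : (0 < N)%N by apply: leq_trans kN; rewrite expn_gt0.
have kL : (k <= trunc_log 2 N)%N by apply: trunc_log_max.
have [Lln lnL] := trunc_log_ln R N0.
have d0 : (0 < k.-1)%N by lia.
have k0 : 0 < k%:R :> R by rewrite ltr0n; lia.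
move: kL Lln lnL (online_coloring R N d0); set L := trunc_log 2 N => kL Lln lnL.
case=> alg algP; exists (L %/ k.-1 * 4 + 3).+1.
have Ldiv := divn_eq L k.-1; have Lmod := ltn_pmod L d0.
split; [|split].
- rewrite mul1r ler_pdivrMr// -natrM; apply: le_trans lnL _; rewrite ler_nat; nia.
- rewrite mulrA ler_pdivlMr// -natrM.
  apply: (@le_trans _ _ (12 * L)%:R); first by rewrite ler_nat; nia.
  by rewrite natrM; lra.
- exists alg => s us sN i /andP[_ iN] W wW mono.
  have := algP (take i s) (take_uniq _ us) _ W wW mono.
  by rewrite size_take_min sN geq_minr => /(_ isT); lia.
Qed.
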